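(* Let $\&$ be a left-continuous t-norm. Then $P$ is a fuzzy order on $\mathbb{E}^1$ and is separated; that is, for all $u,v,w\in\mathbb{E}^1$: $P(u,u)=1$; $P(v,w)\,\&\,P(u,v)\le P(u,w)$; and $P(u,v)=P(v,u)=1$ implies $u=v$.
   Context: T-norms: a t-norm is a commutative, associative binary operation $\&$ on $[0,1]$, monotone in each variable, with $x\,\&\,1=x$; left-continuous means left-continuous in each variable. Its residual implication is $x\to y=\sup\{t\in[0,1]\mid x\,\&\,t\le y\}$. Fuzzy numbers: $\mathbb{E}^1$ is the set of functions $u:\mathbb{R}\to[0,1]$ such that (1) $u(x_0)=1$ for some $x_0$; (2) $u(\lambda x+(1-\lambda)y)\ge\min\{u(x),u(y)\}$ for all $x,y\in\mathbb{R},\lambda\in[0,1]$; (3) $u$ is upper-semicontinuous; (4) $[u]_0=\overline{\{x: u(x)>0\}}$ is compact. Put $[u]_\alpha=\{x: u(x)\ge\alpha\}$ for $\alpha\in(0,1]$ and write $[u]_\alpha=[u_\alpha^-,u_\alpha^+]$. The left and right parts of $u$ are $u^\ell,u^r:\mathbb{R}\to[0,1]$: $u^\ell(x)=0$ for $x<u_0^-$, $u^\ell(x)=u(x)$ for $x\in[u_0^-,u_1^-]$, $u^\ell(x)=1$ for $x>u_1^-$; $u^r(x)=1$ for $x<u_1^-$, $u^r(x)=u(x)$ for $x\in[u_1^-,u_0^+]$, $u^r(x)=0$ for $x>u_0^+$. Define $P(u,v)=\inf_{x\in\mathbb{R}}\big((v^\ell(x)\to u^\ell(x))\wedge(u^r(x)\to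 v^r(x))\big)$. *)

(* Defs.v *)
From HB Require Import structures.
From mathcomp Require Import all_boot all_order all_algebra.
From mathcomp Require Import all_classical all_reals all_analysis.

Set Implicit Arguments.
Unset Strict Implicit.
Unset Printing Implicit Defensive.

Import Order.TTheory GRing.Theory Num.Theory.
Import numFieldNormedType.Exports.
Local Open Scope classical_set_scope.
Local Open Scope ring_scope.

(* Functions to or from [0, 1] are represented by functions to or from R whose
   values, resp. arguments, are restricted to the interval by hypothesis. *)

Section Tnorm.
Variable R : realType.

Record tnorm (op : R -> R -> R) : Prop := Tnorm {
  tnorm_itv : forall x y, 0 <= x <= 1 -> 0 <= y <= 1 -> 0 <= op x y <= 1 ;
  tnormC : forall x y, 0 <= x <= 1 -> 0 <= y <= 1 -> op x y = op y x ;
  tnormA : forall x y z, 0 <= x <= 1 -> 0 <= y <= 1 -> 0 <= z <= 1 ->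
    op x (op y z) = op (op x y) z ;
  tnorm_homol : forall x x' y, 0 <= x <= 1 -> 0 <= x' <= 1 -> 0 <= y <= 1 ->
    x <= x' -> op x y <= op x' y ;
  tnorm_homor : forall x y y', 0 <= x <= 1 -> 0 <= y <= 1 -> 0 <= y' <= 1 ->
    y <= y' -> op x y <= op x y' ;
  tnorm1 : forall x, 0 <= x <= 1 -> op x 1 = x }.

(* Left limits are taken at points of ]0, 1] only: nothing is required at 0,
   which has no point of [0, 1] on its left. *)
Definition left_continuous_each (op : R -> R -> R) : Prop :=
  (forall x y, 0 < x <= 1 -> 0 <= y <= 1 -> op t y @[t --> x^'-] --> op x y) /\
  (forall x y, 0 <= x <= 1 -> 0 < y <= 1 -> op x t @[t --> y^'-] --> op x y).

Definition residuum (op : R -> R -> R) (x y : R) : R :=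
  sup [set t | 0 <= t <= 1 /\ op x t <= y].

End Tnorm.

Section FuzzyOrder.
Variables (R : realType) (T : Type).

Record fuzzy_order (op : R -> R -> R) (A : set T) (P : T -> T -> R) : Prop :=
  FuzzyOrder {
    fuzzy_order_itv : forall u v, A u -> A v -> 0 <= P u v <= 1 ;
    fuzzy_order_refl : forall u, A u -> P u u = 1 ;
    fuzzy_order_trans : forall u v w, A u -> A v -> A w ->
      op (P v w) (P u v) <= P u w }.

Definition fuzzy_separated (A : set T) (P : T -> T -> R) : Prop :=
  forall u v, A u -> A v -> P u v = 1 -> P v u = 1 -> u = v.

End FuzzyOrder.

Section FuzzyNumber.
Variable R : realType.
Implicit Types u v : R -> R.

(* Real-valued, upper counterpart of [lower_semicontinuous]. *)
Definition upper_semicontinuous u : Prop :=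
  forall x a, u x < a -> \forall y \near x, u y < a.

Definition level u (a : R) : set R :=
  if a == 0 then closure [set x | 0 < u x] else [set x | a <= u x].

Record is_fuzzy_number u : Prop := IsFuzzyNumber {
  fuzzy_number_itv : forall x, 0 <= u x <= 1 ;
  fuzzy_number_normal : exists x0, u x0 = 1 ;
  fuzzy_number_convex : forall x y l, 0 <= l <= 1 ->
    Num.min (u x) (u y) <= u (l * x + (1 - l) * y) ;
  fuzzy_number_usc : upper_semicontinuous u ;
  fuzzy_number_compact : compact (level u 0) }.

Definition fuzzy_numbers : set (R -> R) := [set u | is_fuzzy_number u].

(* For a fuzzy number u and 0 <= a <= 1, [level u a] is a nonempty compact
   interval, whose endpoints are its infimum and supremum. *)
Definition level_lo u (a : R) : R := inf (level u a).
Definition level_hi u (a : R) : R := sup (level u a).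

Definition left_part u (x : R) : R :=
  if x < level_lo u 0 then 0
  else if x <= level_lo u 1 then u x
  else 1.

Definition right_part u (x : R) : R :=
  if x < level_lo u 1 then 1
  else if x <= level_hi u 0 then u x
  else 0.

Definition fuzzy_P (op : R -> R -> R) u v : R :=
  inf (range (fun x : R =>
    Num.min (residuum op (left_part v x) (left_part u x))
            (residuum op (right_part u x) (right_part v x)))).

End FuzzyNumber.

Arguments fuzzy_numbers : clear implicits.

(* Main.v *)
Require Import Defs.
From HB Require Import structures.
From mathcomp Require Import all_boot all_order all_algebra.
From mathcomp Require Import all_classical all_reals all_analysis.

(** The argument rests on two facts.

    The residual implication is adjoint to the t-norm: [op x t <= y] holds
    exactly when [t <= residuum op x y] ([residuum_adj]).  This is where left
    continuity enters, as it makes the supremum defining the residuum a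
    maximum.  Taking the infimum over all points, [fuzzy_P op u v] is the
    greatest [t] of [0, 1] such that [op (v^l x) t <= u^l x] and
    [op (u^r x) t <= v^r x] for all [x] ([fuzzy_P_adj]).  Reflexivity is then
    the case [t = 1].  For transitivity, if [s] and [t] satisfy these
    inequalities for [(v, w)] and [(u, v)] respectively, then associativity
    lets [op s t] be applied one factor at a time, so that it satisfies them
    for [(u, w)]: going from [w^l] through [v^l] to [u^l], and, once [s] and
    [t] are commuted, from [u^r] through [v^r] to [w^r].

    A fuzzy number is the pointwise minimum of its left and right parts
    ([fuzzy_number_min_parts]).  If [fuzzy_P op u v] and [fuzzy_P op v u] are
    both 1, the case [t = 1] of the adjunction bounds each part of [u] by the
    same part of [v] and conversely; the parts then agree, hence so do [u] and
    [v]. *)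

Set Implicit Arguments.
Unset Strict Implicit.
Unset Printing Implicit Defensive.

Import Order.TTheory GRing.Theory Num.Theory.
Import numFieldNormedType.Exports.
Local Open Scope classical_set_scope.
Local Open Scope ring_scope.

Lemma tnorm_x0 (R : realType) (op : R -> R -> R) (x : R) :
  tnorm op -> 0 <= x <= 1 -> op x 0 = 0.
Proof.
move=> T x01; have [x0 x1] := andP x01.
have I0 : 0 <= (0 : R) <= 1 by rewrite ?lexx ?ler01.
have I1 : 0 <= (1 : R) <= 1 by rewrite ?lexx ?ler01.
apply/eqP; rewrite eq_le; case/andP: (tnorm_itv T x01 I0) => -> _.
by rewrite andbT (le_trans (tnorm_homol T x01 I1 I0 x1))// (tnormC T)// (tnorm1 T).
Qed.

Lemma residuum_itv (R : realType) (op : R -> R -> R) (x y : R) :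
  tnorm op -> 0 <= x <= 1 -> 0 <= y <= 1 -> 0 <= residuum op x y <= 1.
Proof.
move=> T x01 /andP[y0 _].
have S0 : [set t | 0 <= t <= 1 /\ op x t <= y] 0.
  by split; rewrite ?lexx ?ler01 ?(tnorm_x0 T).
have S1 : ubound [set t | 0 <= t <= 1 /\ op x t <= y] 1 by move=> t [/andP[]].
apply/andP; split; first by apply: ub_le_sup => //; exists 1.
by apply: ge_sup => //; exists 0.
Qed.

(** Below the supremum [s] every [t] satisfies [op x t <= y] by monotonicity,
    and left continuity carries the inequality to [s] itself. *)
Lemma residuum_max (R : realType) (op : R -> R -> R) (x y : R) :
  tnorm op -> left_continuous_each op -> 0 <= x <= 1 -> 0 <= y <= 1 ->
  op x (residuum op x y) <= y.
Proof.
move=> T [_ lc] x01 y01; have s01 := residuum_itv T x01 y01.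
have [s0 s1] := andP s01.
move: s0; rewrite le_eqVlt => /predU1P[<-|s0].
  by rewrite (tnorm_x0 T)//; case/andP: y01.
have ls01 : 0 < residuum op x y <= 1 by rewrite s0.
apply: (cvgr_to_le (lc _ _ x01 ls01)); near=> t.
have t0 : 0 <= t by apply: ltW; near: t; exact: nbhs_left_gt.
have ts : t < residuum op x y by near: t; exact: nbhs_left_lt.
have [|t' [t'01 xt'] tt'] := sup_gt _ ts.
  by exists 0; split; rewrite ?lexx ?ler01 ?(tnorm_x0 T)//; case/andP: y01.
apply: le_trans xt'; apply: (tnorm_homor T) => //; last exact: ltW.
by rewrite t0 (le_trans (ltW ts)).
Unshelve. all: by end_near. Qed.

Lemma residuum_adj (R : realType) (op : R -> R -> R) (x y t : R) :
  tnorm op -> left_continuous_each op ->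
  0 <= x <= 1 -> 0 <= y <= 1 -> 0 <= t <= 1 ->
  (t <= residuum op x y) = (op x t <= y).
Proof.
move=> T lc x01 y01 t01; apply/idP/idP => [ts|xt].
  apply: le_trans (residuum_max T lc x01 y01).
  by apply: (tnorm_homor T) => //; exact: residuum_itv.
by apply: ub_le_sup => //; exists 1 => z [/andP[]].
Qed.

Lemma left_part_itv (R : realType) (u : R -> R) (x : R) :
  is_fuzzy_number u -> 0 <= left_part u x <= 1.
Proof.
move=> U; rewrite /left_part; case: ifP => _; first by rewrite ?lexx ?ler01.
by case: ifP => _; [exact: fuzzy_number_itv|rewrite ?lexx ?ler01].
Qed.

Lemma right_part_itv (R : realType) (u : R -> R) (x : R) :
  is_fuzzy_number u -> 0 <= right_part u x <= 1.
Proof.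
move=> U; rewrite /right_part; case: ifP => _; first by rewrite ?lexx ?ler01.
by case: ifP => _; [exact: fuzzy_number_itv|rewrite ?lexx ?ler01].
Qed.

Lemma fuzzy_P_itv (R : realType) (op : R -> R -> R) (u v : R -> R) :
  tnorm op -> is_fuzzy_number u -> is_fuzzy_number v ->
  0 <= fuzzy_P op u v <= 1.
Proof.
move=> T U V.
have I x : 0 <= Num.min (residuum op (left_part v x) (left_part u x))
                (residuum op (right_part u x) (right_part v x)) <= 1.
  have /andP[l0 l1] :=
    residuum_itv T (left_part_itv x V) (left_part_itv x U).
  have /andP[r0 _] :=
    residuum_itv T (right_part_itv x U) (right_part_itv x V).
  by rewrite le_min l0 r0 ge_min l1.
apply/andP; split.
  apply: lb_le_inf; first by eexists; exists 0.
  by move=> _ [x _ <-]; case/andP: (I x).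
have [_ I1] := andP (I 0); apply: le_trans I1; apply: ge_inf; last by exists 0.
by exists 0 => _ [x _ <-]; case/andP: (I x).
Qed.

(** [fuzzy_P] inherits an adjunction from the residuum because a lower bound
    of an infimum of minima is a common lower bound of all the residua. *)
Lemma fuzzy_P_adj (R : realType) (op : R -> R -> R) (u v : R -> R) (t : R) :
  tnorm op -> left_continuous_each op ->
  is_fuzzy_number u -> is_fuzzy_number v -> 0 <= t <= 1 ->
  t <= fuzzy_P op u v <->
  forall x, op (left_part v x) t <= left_part u x /\
            op (right_part u x) t <= right_part v x.
Proof.
move=> T lc U V t01.
have E x : (t <= Num.min (residuum op (left_part v x) (left_part u x))
                  (residuum op (right_part u x) (right_part v x))) =
           (op (left_part v x) t <= left_part u x) &&
           (op (right_part u x) t <= right_part v x).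
  by rewrite le_min !(residuum_adj T lc)//;
    solve [exact: left_part_itv|exact: right_part_itv].
split=> [tP x|H].
  apply/andP; rewrite -E; apply: le_trans tP _.
  apply: ge_inf; last by exists x.
  exists 0 => _ [z _ <-]; rewrite le_min.
  by apply/andP; split; [case/andP: (residuum_itv T (left_part_itv z V)
    (left_part_itv z U))|case/andP: (residuum_itv T (right_part_itv z U)
    (right_part_itv z V))].
apply: lb_le_inf; first by eexists; exists 0.
by move=> _ [x _ <-]; rewrite E; apply/andP.
Qed.

Lemma fuzzy_P_eq1 (R : realType) (op : R -> R -> R) (u v : R -> R) :
  tnorm op -> left_continuous_each op ->
  is_fuzzy_number u -> is_fuzzy_number v ->
  fuzzy_P op u v = 1 <->
  forall x, left_part v x <= left_part u x /\
            right_part u x <= right_part v x.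
Proof.
move=> T lc U V.
have I1 : 0 <= (1 : R) <= 1 by rewrite ?lexx ?ler01.
have [adjl adjr] := fuzzy_P_adj T lc U V I1.
split=> [P1 x|H].
  have := adjl; rewrite P1 => /(_ (lexx 1) x).
  by rewrite !(tnorm1 T)//; [exact: right_part_itv|exact: left_part_itv].
apply/eqP; rewrite eq_le; case/andP: (fuzzy_P_itv T U V) => _ -> /=.
apply: adjr => x.
by rewrite !(tnorm1 T)//; [exact: right_part_itv|exact: left_part_itv].
Qed.

Lemma fuzzy_number_level0 (R : realType) (u : R -> R) (x : R) :
  is_fuzzy_number u -> 0 < u x -> level_lo u 0 <= x <= level_hi u 0.
Proof.
move=> U ux; have Lx : level u 0 x.
  by rewrite /level eqxx; exact: subset_closure.
have [M [_ /(_ (M + 1))]] := compact_bounded (fuzzy_number_compact U).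
rewrite ltrDl ltr01 => /(_ isT) bnd.
apply/andP; split; [apply: ge_inf => //|apply: ub_le_sup => //].
- by exists (- (M + 1)) => z /bnd /=; rewrite ler_norml => /andP[].
- by exists (M + 1) => z /bnd /=; rewrite ler_norml => /andP[].
Qed.

(** A point where [u] is 1 lies to the right of [level_lo u 1] and to the left
    of [level_hi u 0], so at [level_lo u 1] neither part has switched to the
    constant 0.  At any other point either one part is 1 and the other agrees
    with [u], or [u] and one of the parts are 0. *)
Lemma fuzzy_number_min_parts (R : realType) (u : R -> R) (x : R) :
  is_fuzzy_number u -> Num.min (left_part u x) (right_part u x) = u x.
Proof.
move=> U; have u01 z : 0 <= u z <= 1 by exact: fuzzy_number_itv.
have /andP[u0 u1] := u01 x.
have out : ~~ (level_lo u 0 <= x <= level_hi u 0) -> u x = 0.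
  move=> nx; apply/eqP; rewrite eq_le u0 andbT leNgt.
  by apply: contra nx; exact: fuzzy_number_level0.
have lo1_hi0 : level_lo u 1 <= level_hi u 0.
  have [x0 ux0] := fuzzy_number_normal U.
  have /andP[_] : level_lo u 0 <= x0 <= level_hi u 0.
    by apply: fuzzy_number_level0; rewrite ?ux0 ?ltr01.
  apply: le_trans; apply: ge_inf; last by rewrite /level oner_eq0 /= ux0.
  exists (level_lo u 0) => z; rewrite /level oner_eq0 /= => uz.
  have : 0 < u z by exact: lt_le_trans uz.
  by move=> /(fuzzy_number_level0 U) /andP[].
have [xlo|lox] := ltP x (level_lo u 0).
  rewrite /left_part xlo out; last by rewrite leNgt xlo.
  by apply/min_idPl; case/andP: (right_part_itv x U).
rewrite /left_part ltNge lox /=.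
rewrite /right_part; have [x1|x1|x1] := ltgtP x (level_lo u 1).
- exact/min_idPl.
- case: ifPn => [_|hix]; first exact/min_idPr.
  by rewrite out ?negb_and ?hix ?orbT//; apply/min_idPr/ler01.
- by rewrite x1 lo1_hi0 minxx.
Qed.

Theorem proposition3p6 (R : realType) (op : R -> R -> R) :
  tnorm op -> left_continuous_each op ->
  fuzzy_order op (fuzzy_numbers R) (fuzzy_P op) /\
  fuzzy_separated (fuzzy_numbers R) (fuzzy_P op).
Proof.
move=> T lc; split; first split.
- by move=> u v U V; exact: fuzzy_P_itv.
- by move=> u U; apply/(fuzzy_P_eq1 T lc U U) => x; rewrite !lexx.
- move=> u v w U V W.
  have uv01 := fuzzy_P_itv T U V; have vw01 := fuzzy_P_itv T V W.
  have Huv := (fuzzy_P_adj T lc U V uv01).1 (lexx _).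
  have Hvw := (fuzzy_P_adj T lc V W vw01).1 (lexx _).
  apply/(fuzzy_P_adj T lc U W (tnorm_itv T vw01 uv01)) => x.
  have [[luv ruv] [lvw rvw]] := (Huv x, Hvw x).
  have [lu lv lw] := And3 (left_part_itv x U)
    (left_part_itv x V) (left_part_itv x W).
  have [ru rv rw] := And3 (right_part_itv x U)
    (right_part_itv x V) (right_part_itv x W).
  split.
  + rewrite (tnormA T)//; apply: le_trans luv.
    by apply: (tnorm_homol T) => //; exact: tnorm_itv.
  + rewrite (tnormC T vw01 uv01) (tnormA T)//; apply: le_trans rvw.
    by apply: (tnorm_homol T) => //; exact: tnorm_itv.
- move=> u v U V /(fuzzy_P_eq1 T lc U V) Huv /(fuzzy_P_eq1 T lc V U) Hvu.
  apply/funext => x.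
  have [[l1 r1] [l2 r2]] := (Huv x, Hvu x).
  rewrite -(fuzzy_number_min_parts x U) -(fuzzy_number_min_parts x V).
  by congr Num.min; apply/le_anti/andP.
Qed.
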